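(* Let $G,H$ be primitive graphs and let $P:\mathcal{E}_G\times\mathcal{E}_H\to\mathbb{Z}$ be a function. Then both $X_H^\dagger$ and $Y_{(H,G)}^\dagger$ are sofic shifts.
   Context: A graph $G=(\mathcal{V}_G,\mathcal{E}_G)$ means a finite directed graph; each edge $e\in\mathcal{E}_G$ has a source $s(e)$ and a target $t(e)$ in $\mathcal{V}_G$; parallel edges and self-loops are allowed. A walk of length $n\ge1$ is a tuple $(e_1,\dots,e_n)\in\mathcal{E}_G^n$ with $t(e_k)=s(e_{k+1})$ for $1\le k<n$. $\mathcal{W}_n(G,v\to w)$ is the set of walks of length $n$ with $s(e_1)=v$, $t(e_n)=w$, and $\mathcal{W}_n(G)$ is the set of all walks of length $n$. $G$ is irreducible if any two vertices are connected by a walk; an irreducible graph is primitive if the gcd of the lengths of all its cycles (walks with $s(e_1)=t(e_n)$) is $1$. For $p\in\mathcal{W}_n(H)$ and $v,w\in\mathcal{V}_G$ let $M(p,v\to w)=\inf_{q\in\mathcal{W}_n(G,v\to w)}\sum_{i=1}^n P(q_i,p_i)\in\mathbb{Z}\cup\{+\infty\}$ (with $\inf\emptyset=+\infty$), and let $M(p):\mathcal{V}_G\times\mathcal{V}_G\to\mathbb{Z}\cup\{+\infty\}$ be $(v,w)\mapsto M(p,v\to w)$. For functions $f,g:\mathcal{V}_G\times\mathcal{V}_G\to\mathbb{Z}\cup\{+\infty\}$ write $f<g$ if $f(v,w)<g(v,w)$ for all $v,w$. For $u,u'\in\mathcal{V}_H$, a walk $p\in\mathcal{W}_n(H,u\to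 u')$ is non-improvable if there is no $p'\in\mathcal{W}_n(H,u\to u')$ with $M(p)<M(p')$; $\mathcal{W}_n^\dagger(H)$ is the set of all non-improvable walks of length $n$ in $H$. For $p\in\mathcal{W}_n(H)$ let $\mathcal{R}(p)=\bigcup_{v,w\in\mathcal{V}_G}\{q\in\mathcal{W}_n(G,v\to w): M(p,v\to w)=\sum_{j=1}^n P(q_j,p_j)\}$. Let $X_G=\{x\in\mathcal{E}_G^{\mathbb{Z}}: t(x_n)=s(x_{n+1})\ \forall n\in\mathbb{Z}\}$ and similarly $X_H$. Write $x_{[m,n]}=(x_m,\dots,x_n)$. Define $$X_H^\dagger=\{x\in X_H: x_{[m,n]}\in\mathcal{W}^\dagger_{n-m+1}(H)\ \forall m<n\},$$ $$Y_{(H,G)}^\dagger=\{(x,y)\in X_H^\dagger\times X_G: y_{[m,n]}\in\mathcal{R}(x_{[m,n]})\ \forall m<n\},$$ the latter regarded as a subset of $(\mathcal{E}_H\times\mathcal{E}_G)^{\mathbb{Z}}$. A shift space $S\subseteq\Sigma^{\mathbb{Z}}$ ($\Sigma$ finite) is sofic if there are a graph $K$ and a labeling $L:\mathcal{E}_K\to\Sigma$ such that $S$ is the set of bi-infinite label sequences $(L(e_n))_{n\in\mathbb{Z}}$ of bi-infinite walks $(e_n)_{n\in\mathbb{Z}}$ in $K$. *)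

(* Defs.v *)
From mathcomp Require Import all_boot all_order all_algebra.
From mathcomp Require Export constructive_ereal.

Set Implicit Arguments.
Unset Strict Implicit.
Unset Printing Implicit Defensive.

Import Order.TTheory GRing.Theory Num.Theory.
Local Open Scope ring_scope.

Record digraph := Digraph {
  vertex : finType;
  edge : finType;
  src : edge -> vertex;
  tgt : edge -> vertex }.

Arguments src {d} _.
Arguments tgt {d} _.

Section Walks.
Variable G : digraph.

(* A walk has length at least 1, so the empty sequence is not one. *)
Definition is_walk (v w : vertex G) (p : seq (edge G)) : bool :=
  if p is e :: p' then
    [&& src e == v, path (fun e f => tgt e == src f) e p'
      & tgt (last e p') == w]
  else false.

Definition walks (n : nat) (v w : vertex G) : {set n.-tuple (edge G)} :=
  [set p : n.-tuple (edge G) | is_walk v w p].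

Definition irreducible_graph : Prop :=
  forall v w : vertex G, exists p : seq (edge G), is_walk v w p.

Definition cycle_length (n : nat) : Prop :=
  exists (v : vertex G) (p : seq (edge G)), is_walk v v p /\ size p = n.

End Walks.

(* The gcd of a possibly infinite set of natural numbers; it is 0 for the
   empty set. *)
Definition is_gcd (S : nat -> Prop) (g : nat) : Prop :=
  (forall n, S n -> g %| n)%N /\
  (forall d, (forall n, S n -> d %| n) -> d %| g)%N.

Definition primitive_graph (G : digraph) : Prop :=
  irreducible_graph G /\ is_gcd (@cycle_length G) 1.

Section Potential.
Variables (G H : digraph) (P : edge G -> edge H -> int).

Definition weight (n : nat) (q : n.-tuple (edge G)) (p : n.-tuple (edge H))
    : int :=
  \sum_(i < n) P (tnth q i) (tnth p i).

(* A minimum over a finite set, equal to +oo when the set is empty; the value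
   -oo of [\bar int] is never taken. *)
Definition M (n : nat) (p : n.-tuple (edge H)) (v w : vertex G) : \bar int :=
  \big[Order.min/+oo%E]_(q in walks n v w) (weight q p)%:E.

(* Strict at every pair of vertices: in particular +oo < +oo is false. *)
Definition lt_all (f g : vertex G -> vertex G -> \bar int) : bool :=
  [forall v, forall w, (f v w < g v w)%E].

Definition non_improvable (n : nat) (u u' : vertex H)
    (p : n.-tuple (edge H)) : bool :=
  ~~ [exists p' in walks n u u', lt_all (M p) (M p')].

Definition non_improvable_walks (n : nat) : {set n.-tuple (edge H)} :=
  \bigcup_(u : vertex H) \bigcup_(u' : vertex H)
    [set p in walks n u u' | non_improvable u u' p].

Definition minimizers (n : nat) (p : n.-tuple (edge H))
    : {set n.-tuple (edge G)} :=
  \bigcup_(v : vertex G) \bigcup_(w : vertex G)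
    [set q in walks n v w | M p v w == (weight q p)%:E].

End Potential.

(* The word x_m ... x_n, of length n - m + 1; only used when m <= n. *)
Definition window (A : Type) (x : int -> A) (m n : int)
    : (absz (n - m)%R).+1.-tuple A :=
  [tuple x (m + i%:Z) | i < (absz (n - m)%R).+1].

Definition biinfinite_walk (G : digraph) (x : int -> edge G) : Prop :=
  forall n : int, tgt (x n) = src (x (n + 1)).

Definition X_dagger (G H : digraph) (P : edge G -> edge H -> int)
    (x : int -> edge H) : Prop :=
  biinfinite_walk x /\
  forall m n : int, m < n -> window x m n \in non_improvable_walks P _.

Definition Y_dagger (G H : digraph) (P : edge G -> edge H -> int)
    (z : int -> edge H * edge G) : Prop :=
  let x := fun n => (z n).1 in
  let y := fun n => (z n).2 in
  [/\ X_dagger P x, biinfinite_walk y &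
      forall m n : int, m < n -> window y m n \in minimizers P (window x m n)].

(* Shift spaces are the sets of sequences avoiding a set of forbidden words;
   the empty set is one of them. *)
Definition shift_space (A : finType) (S : (int -> A) -> Prop) : Prop :=
  exists forbidden : seq A -> Prop, forall x : int -> A,
    S x <-> forall m n : int, m <= n -> ~ forbidden (window x m n).

Definition sofic (A : finType) (S : (int -> A) -> Prop) : Prop :=
  shift_space S /\
  exists (K : digraph) (L : edge K -> A), forall x : int -> A,
    S x <-> exists e : int -> edge K,
              biinfinite_walk e /\ forall n : int, x n = L (e n).

(* Main.v *)
Require Import Defs.
From mathcomp Require Import all_boot all_order all_algebra.
From mathcomp Require Import boolp.
From mathcomp Require Import zify.

(* A factorial language with finitely many follower sets on long words defines
   a sofic shift: along a point, the follower sets of longer and longer pasts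
   decrease, so they are eventually constant, and their limits are the states.

   For non-improvable walks, what follows p is governed by the matrices M(p')
   of the walks p' with the same length and source as p, relative to M(p).  By
   primitivity of G, the entries of M(p) differ by a bounded amount, uniformly
   in p.  A p' with M(p') much above M(p) would give an improvement of p, after
   rerouting its end by primitivity of H.  A p' with M(p') much below M(p) can
   only improve an extension p r if r itself, together with the preceding N
   edges, is already improvable.  Hence the differences matter only up to a
   bounded cutoff.  A pair (p, q) only requires, in addition, the endpoints
   of q. *)

Set Implicit Arguments.
Unset Strict Implicit.
Unset Printing Implicit Defensive.

Import Order.TTheory GRing.Theory Num.Theory.
Local Open Scope ring_scope.

(** * Finite words of bi-infinite sequences *)

Definition word (A : Type) (x : int -> A) (m : int) (k : nat) : seq A :=
  [seq x (m + i%:Z) | i <- iota 0 k].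

Lemma word_cat (A : Type) (x : int -> A) m k l :
  word x m (k + l) = word x m k ++ word x (m + k%:Z) l.
Proof.
rewrite /word iotaD map_cat add0n; congr cat.
rewrite -[in LHS](addn0 k) iotaDl -map_comp; apply: eq_map => i /=.
by rewrite PoszD addrA.
Qed.

Lemma word1 (A : Type) (x : int -> A) m : word x m 1 = [:: x m].
Proof. by rewrite /word /= addr0. Qed.

Lemma size_word (A : Type) (x : int -> A) m k : size (word x m k) = k.
Proof. by rewrite size_map size_iota. Qed.

Lemma val_window (A : Type) (x : int -> A) m n :
  window x m n = word x m (absz (n - m)).+1 :> seq A.
Proof.
by rewrite /word -val_enum_ord -map_comp.
Qed.

Lemma all_windowP (A : Type) (L : seq A -> Prop) (x : int -> A) :
  (forall m n, m <= n -> L (window x m n)) <->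
  (forall m k, L (word x m k.+1)).
Proof.
split=> [h m k|h m n _]; last by rewrite val_window.
have := h m (m + k%:Z); rewrite val_window addrAC subrr add0r /=.
by apply; rewrite lerDl.
Qed.

Lemma infinite_pigeonhole (T : finType) (f : nat -> T) :
  exists t, forall m, exists2 k, (m <= k)%N & f k = t.
Proof.
apply: contrapT => /forallNP h.
have {}h t : exists m, forall k, (m <= k)%N -> f k <> t.
  have /existsNP[m hm] := h t; exists m => k mk fk; apply: hm.
  by exists k.
have [b hb] := fin_all_exists h.
by apply: (hb (f (\max_t b t)) (\max_t b t)) => //; apply: leq_bigmax.
Qed.

(** * Factorial languages with finitely many follower sets *)

Section SoficLanguage.
Variables (A T : finType) (L : seq A -> Prop) (cls : seq A -> T) (N : nat).
Hypothesis L_factor : forall a b, L (a ++ b) -> L a /\ L b.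
Hypothesis cls_follow : forall w w', (N <= size w)%N -> (N <= size w')%N ->
  L w -> L w' -> cls w = cls w' -> forall r, L (w ++ r) -> L (w' ++ r).

(** [w'] may be a past of another length than [w] followed by [a]. Hence only an inclusion of
    follower sets is asked, in the direction that pulls membership in [L] back along a walk. *)
Definition follower_step (t : T) (a : A) (t' : T) : Prop :=
  exists w w', [/\ (N <= size w)%N, (N <= size w')%N, cls w = t, cls w' = t' &
    [/\ L w', L (w ++ [:: a]) & forall r, L (w' ++ r) -> L (w ++ a :: r)]].

Definition follower_graph : digraph :=
  @Digraph T {z : T * A * T | `[< follower_step z.1.1 z.1.2 z.2 >]}
    (fun e => (val e).1.1) (fun e => (val e).2).

(* The follower sets of the words [x_(n-k) ... x_(n-1)] decrease with [k], so
   they are eventually constant. *)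
Lemma followers_stabilize (x : int -> A) (n : int) :
  (forall m k, L (word x m k)) ->
  exists2 k, (N <= k)%N & forall j, (k <= j)%N ->
    forall r, L (word x (n - k%:Z) k ++ r) -> L (word x (n - j%:Z) j ++ r).
Proof.
move=> Lx.
(* Some class occurs for arbitrarily long pasts, and every past is a suffix of one in that class. *)
have [t ht] := infinite_pigeonhole (fun k => cls (word x (n - k%:Z) k)).
have [k Nk kt] := ht N; exists k => // j kj r Lr.
have [i ji it] := ht j.
have : L (word x (n - i%:Z) i ++ r).
  apply: cls_follow Lr; rewrite ?size_word ?kt ?it //.
  by apply: leq_trans Nk (leq_trans kj ji).
rewrite -{2}(subnK ji) word_cat -catA => /L_factor[_].
by congr (L (word x _ _ ++ _)); lia.
Qed.

Lemma follower_graph_walk (x : int -> A) :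
  (forall m k, L (word x m k)) ->
  exists e : int -> edge follower_graph,
    biinfinite_walk e /\ forall n, x n = (val (e n)).1.2.
Proof.
move=> Lx.
have /choice[k hk] : forall n, exists k, (N <= k)%N /\ forall j, (k <= j)%N ->
    forall r, L (word x (n - k%:Z) k ++ r) -> L (word x (n - j%:Z) j ++ r).
  by move=> n; have [k ? ?] := followers_stabilize n Lx; exists k.
pose w n := word x (n - (k n)%:Z) (k n).
have stepP n : `[< follower_step (cls (w n)) (x n) (cls (w (n + 1))) >].
  apply/asboolP; exists (w n), (w (n + 1)); rewrite !size_word.
  have [Nk _] := hk n; have [Nk1 stab] := hk (n + 1).
  have wx : w n ++ [:: x n] = word x (n - (k n)%:Z) (k n).+1.
    by rewrite -addn1 word_cat word1 subrK.
  split=> //; split; [exact: Lx | by rewrite wx; apply: Lx |].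
  move=> r Lr; rewrite -cat1s catA wx.
  (* The maximum makes the past long enough both for stabilization at [n + 1] and to have [w n ++
     [:: x n]] as a suffix. *)
  have /stab/(_ r Lr) : (k (n + 1)%R <= maxn (k (n + 1)%R) (k n).+1)%N.
    exact: leq_maxl.
  set j := maxn _ _; have kj : ((k n).+1 <= j)%N by apply: leq_maxr.
  rewrite -{2}(subnK kj) word_cat -catA => /L_factor[_].
  by congr (L (word x _ _ ++ _)); lia.
exists (fun n => Sub (_, _, _) (stepP n)).
by split=> n.
Qed.

(** The follower inclusions compose backwards along the walk: any long word of [L] in the class of
    the first state can be followed by the labels read. *)
Lemma follower_graph_label (x : int -> A) (e : int -> edge follower_graph) :
  biinfinite_walk e -> (forall n, x n = (val (e n)).1.2) ->
  forall m k, L (word x m k).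
Proof.
move=> ew xe m k.
have key : forall k m w, (N <= size w)%N -> L w -> cls w = (val (e m)).1.1 ->
    L (w ++ word x m k).
  elim=> [|{}k IH] {}m w Nw Lw cw; first by rewrite cats0.
  have /asboolP[w0 [w1 [N0 N1 c0 c1 [L1 L0 h]]]] := valP (e m).
  rewrite -add1n word_cat word1; apply: (cls_follow N0) => //.
  - by case/L_factor: L0.
  - by rewrite c0.
  - by rewrite xe; apply: h; apply: IH => //; rewrite c1; apply: ew.
have /asboolP[w0 [w1 [N0 N1 c0 c1 [L1 L0 h]]]] := valP (e m).
have [] // := L_factor (key k m w0 N0 _ c0).
by case/L_factor: L0.
Qed.

Lemma sofic_of_language (S : (int -> A) -> Prop) :
  (forall x, S x <-> forall m k, L (word x m k.+1)) -> sofic S.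
Proof.
move=> SL; split.
  exists (fun s => ~ L s) => x; rewrite SL -all_windowP.
  by split=> h m n mn; [move=> /(_ (h m n mn)) | apply: contrapT; apply: h].
exists follower_graph, (fun e => (val e).1.2) => x; rewrite SL; split.
  move=> Lx; apply: follower_graph_walk => m [|k] //.
  by have := Lx m 0; rewrite word1 -[[:: _]]cat0s => /L_factor[].
by move=> [e [ew xe]] m k; apply: follower_graph_label ew xe _ _.
Qed.

End SoficLanguage.

(** The least positive difference [d] of two elements divides every element, since a nonzero
    remainder would be a smaller difference. So [d = 1], and consecutive elements [s], [s + 1]
    generate everything from [s * s] on. *)
Lemma numerical_semigroup (S : nat -> Prop) :
  S 0%N -> (forall a b, S a -> S b -> S (a + b)%N) ->
  (forall d, (forall n, S n -> d %| n)%N -> d = 1%N) ->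
  exists N, forall n, (N <= n)%N -> S n.
Proof.
move=> S0 SD gcd1.
have SM k a : S a -> S (k * a)%N.
  by move=> Sa; elim: k => // k; rewrite mulSn; apply: SD.
pose D d := `[< (0 < d)%N /\ exists2 s, S s & S (s + d)%N >].
have exD : exists d, D d.
  apply: contrapT => /forallNP nD.
  have : 0%N = 1%N :> nat; last by [].
  apply: gcd1 => -[//|n] Sn; case: (nD n.+1); apply/asboolP.
  by split=> //; exists 0%N.
case: (ex_minnP exD) => d /asboolP[d0 [s Ss Ssd]] dmin.
have d1 : d = 1%N.
  apply: gcd1 => t St; rewrite /dvdn; apply: contrapT => /negP r0.
  have : (d <= t %% d)%N; last by rewrite leqNgt ltn_mod d0.
  apply: dmin; apply/asboolP; split; first by rewrite lt0n.
  (* [t %% d] is the difference of [t + t %/ d * s] and this element. *)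
  exists (t %/ d * (s + d))%N; first exact: SM.
  suff -> : (t %/ d * (s + d) + t %% d = t + t %/ d * s)%N.
    by apply: SD => //; apply: SM.
  by rewrite mulnDr -addnA -divn_eq addnC.
rewrite {}d1 in Ssd; exists (s * s)%N => n sn.
have [s0|s0] := posnP s.
  by rewrite s0 in Ssd; rewrite -(muln1 n); apply: SM.
have -> : n = ((n %/ s - n %% s) * s + n %% s * (s + 1))%N.
  have h : (n %% s <= n %/ s)%N.
    by apply: leq_trans (ltnW (ltn_pmod n s0)) _; rewrite leq_divRL.
  rewrite {1}(divn_eq n s) mulnBl mulnDr muln1 addnA subnK //.
  by rewrite leq_mul2r h orbT.
by apply: SD; apply: SM.
Qed.

(** * Walks in primitive graphs *)

Section GeneralizedWalks.
Variable G : digraph.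

(* Unlike [is_walk], this allows the empty walk from a vertex to itself. *)
Fixpoint gwalk (v w : vertex G) (q : seq (edge G)) : bool :=
  if q is e :: q' then (src e == v) && gwalk (tgt e) w q' else v == w.

Lemma is_walkE v w q : is_walk v w q = (q != [::]) && gwalk v w q.
Proof.
case: q => //= e q; congr andb.
by elim: q e => //= f q IH e; rewrite eq_sym -IH andbA eq_sym.
Qed.

Lemma gwalk_cat v w p q :
  reflect (exists2 x, gwalk v x p & gwalk x w q) (gwalk v w (p ++ q)).
Proof.
elim: p v => [|e p IH] v /=.
  by apply: (iffP idP) => [|[x /eqP->]] //; exists v.
apply: (iffP andP) => [[ev /IH[x px qx]]|[x /andP[ev px] qx]].
  by exists x; rewrite ?ev.
by split=> //; apply/IH; exists x.
Qed.

Lemma gwalk_split m n v w q : size q = (m + n)%N -> gwalk v w q ->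
  exists q1 q2 x,
    [/\ q = q1 ++ q2, size q1 = m, size q2 = n, gwalk v x q1 & gwalk x w q2].
Proof.
move=> qn; rewrite -{1}(cat_take_drop m q) => /gwalk_cat[x q1w q2w].
exists (take m q), (drop m q), x; split; rewrite ?cat_take_drop //.
  by rewrite size_takel // qn leq_addr.
by rewrite size_drop qn addKn.
Qed.

Definition connected_by (n : nat) : Prop :=
  forall v w, exists2 q, size q = n & gwalk v w q.

(** Irreducibility gives every vertex an outgoing edge, which can be put in front of a connecting
    walk. *)
Lemma connected_byD m n :
  irreducible_graph G -> connected_by m -> connected_by (m + n).
Proof.
move=> Girr cm; elim: n => [|n IH]; first by rewrite addn0.
move=> v w; rewrite addnS; have [[|e p]] := Girr v w => //=.
case/and3P=> ev _ _; have [q qn qw] := IH (tgt e) w.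
by exists (e :: q) => /=; rewrite ?qn ?ev.
Qed.

(** Without vertices there are no cycles, and the gcd of the empty set is 0. *)
Lemma primitive_has_vertex : primitive_graph G -> inhabited (vertex G).
Proof.
move=> [_ [_ gcd1]]; apply: contrapT => nV.
have := gcd1 0%N; rewrite dvd0n => H; suff: (1 == 0)%N by [].
by apply: H => n [v _]; case: nV.
Qed.

Lemma primitive_connected_by :
  primitive_graph G -> exists N, forall n, (N <= n)%N -> connected_by n.
Proof.
move=> Gprim; have [v0] := primitive_has_vertex Gprim.
have [Girr [_ gcd1]] := Gprim.
have [a ha] : exists a : vertex G -> seq (edge G), forall v, is_walk v v0 (a v).
  exact: fin_all_exists (Girr^~ v0).
have [b hb] : exists b : vertex G -> seq (edge G), forall v, is_walk v0 v (b v).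
  exact: fin_all_exists (Girr v0).
pose closed n := exists2 q, size q = n & gwalk v0 v0 q.
have closedD m n : closed m -> closed n -> closed (m + n)%N.
  move=> [p <- pw] [q <- qw]; exists (p ++ q); first exact: size_cat.
  by apply/gwalk_cat; exists v0.
have [] := @numerical_semigroup closed _ closedD.
- by exists [::] => //=.
(* A cycle [c] at [u] gives the closed walks [b u ++ a u] and [b u ++ c ++ a u] at [v0], whose
   lengths differ by that of [c]. *)
- move=> d hd; apply/eqP; rewrite -dvdn1; apply: gcd1 => n [u [c [cu cn]]].
  move: (ha u) (hb u) cu; rewrite !is_walkE.
  move=> /andP[_ au] /andP[_ bu] /andP[_ cu].
  have d1 : (d %| size (a u) + size (b u))%N.
    apply: hd; exists (b u ++ a u); first by rewrite size_cat addnC.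
    by apply/gwalk_cat; exists u.
  rewrite -(dvdn_addl n d1); apply: hd; exists (b u ++ c ++ a u).
    by rewrite !size_cat cn addnCA [(size (b u) + _)%N]addnC.
  by apply/gwalk_cat; exists u => //; apply/gwalk_cat; exists u.
(* The maxima leave room for the walks from [v] to [v0] and from [v0] to [w], with a closed walk at
   [v0] in between. *)
move=> N hN; exists (N + \max_v size (a v) + \max_v size (b v))%N => n hn v w.
have am := @leq_bigmax (vertex G) (fun v => size (a v)) v.
have bm := @leq_bigmax (vertex G) (fun v => size (b v)) w.
have [|q qn qw] := hN (n - size (a v) - size (b w))%N; first by lia.
move: (ha v) (hb w); rewrite !is_walkE => /andP[_ av] /andP[_ bw].
exists (a v ++ q ++ b w); first by rewrite !size_cat qn; lia.
by apply/gwalk_cat; exists v0 => //; apply/gwalk_cat; exists v0.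
Qed.

Lemma in_walks n (v w : vertex G) (q : n.-tuple (edge G)) :
  (0 < n)%N -> (q \in walks n v w) = gwalk v w q.
Proof.
move=> n0; rewrite in_set is_walkE; suff -> : tval q != [::] by [].
by rewrite -size_eq0 size_tuple -lt0n.
Qed.

End GeneralizedWalks.

(** * Improvements and optimal walks, on sequences *)

Section Potential.
Variables (G H : digraph) (P : edge G -> edge H -> int).

Definition wt (q : seq (edge G)) (p : seq (edge H)) : int :=
  \sum_(z <- zip q p) P z.1 z.2.

Lemma wt_cat q q' p p' :
  size q = size p -> wt (q ++ q') (p ++ p') = wt q p + wt q' p'.
Proof. by move=> qp; rewrite /wt zip_cat // big_cat. Qed.

Lemma wt_le_size (b : nat) q p :
  (forall e f, `|P e f| <= b%:Z) -> `|wt q p| <= (size p * b)%:Z.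
Proof.
move=> P_le; elim: p q => [|f p IH] [|e q].
1-3: by rewrite /wt /= big_nil normr0.
have -> : wt (e :: q) (f :: p) = P e f + wt q p by rewrite /wt big_cons.
by have := IH q; have := P_le e f; rewrite /= mulSn; lia.
Qed.

Lemma weightE n (q : n.-tuple (edge G)) (p : n.-tuple (edge H)) :
  weight P q p = wt q p.
Proof.
case: n q p => [|n] q p.
  by rewrite (tuple0 q) (tuple0 p) /weight /wt big_ord0 big_nil.
pose z0 := (tnth q ord0, tnth p ord0).
rewrite /wt (big_nth z0) size_zip !size_tuple minnn big_mkord.
apply: eq_bigr => i _; rewrite nth_zip ?size_tuple //=.
by rewrite -!tnth_nth.
Qed.

Lemma M_le n (p : n.-tuple (edge H)) v w (q : n.-tuple (edge G)) :
  (0 < n)%N -> gwalk v w q -> (M P p v w <= (wt q p)%:E)%E.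
Proof.
by move=> n0 qw; rewrite -weightE; apply: bigmin_le_cond; rewrite in_walks.
Qed.

Lemma M_attained n (p : n.-tuple (edge H)) v w :
  (0 < n)%N -> (exists2 q, size q = n & gwalk v w q) ->
  exists q : n.-tuple (edge G), gwalk v w q /\ M P p v w = (wt q p)%:E.
Proof.
move=> n0 [q /eqP qn qw].
have qW : Tuple qn \in walks n v w by rewrite in_walks.
have [q' q'W Mq'] := eq_bigmin (x := +oo%E) (Tuple qn) _
  (fun q => (weight P q p)%:E) qW (fun q _ => leey (weight P q p)%:E).
by exists q'; rewrite -(in_walks _ _ _ n0) -weightE.
Qed.

Lemma M_pinfty n (p : n.-tuple (edge H)) v w :
  (0 < n)%N -> ~ (exists2 q, size q = n & gwalk v w q) -> M P p v w = +oo%E.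
Proof.
move=> n0 nq; apply: big_pred0 => q; rewrite in_walks //.
by apply/negP => qw; case: nq; exists q; rewrite ?size_tuple.
Qed.

(** This is [lt_all (M P p) (M P p')] without infinities: the first condition makes [M P p] finite
    everywhere. *)
Definition improves (p' p : seq (edge H)) : Prop :=
  connected_by G (size p) /\
  forall v w q', size q' = size p -> gwalk v w q' ->
    exists q, [/\ size q = size p, gwalk v w q & wt q p < wt q' p'].

Lemma lt_all_M n (p p' : n.-tuple (edge H)) :
  (0 < n)%N -> lt_all (M P p) (M P p') <-> improves p' p.
Proof.
move=> n0; rewrite /improves !size_tuple; split.
  move=> /forallP lt; have conn : connected_by G n.
    move=> v w; apply: contrapT => nq.
    by have /forallP/(_ w) := lt v; rewrite (M_pinfty p n0 nq) ltNge leey.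
  split=> // v w q' /eqP qn q'w.
  have [q [qw Mq]] := M_attained p n0 (conn v w).
  exists q; rewrite size_tuple; split=> //.
  have /forallP/(_ w) := lt v; rewrite Mq => /lt_le_trans.
  by move=> /(_ _ (M_le p' n0 (q := Tuple qn) q'w)); rewrite lte_fin.
move=> [conn imp]; apply/forallP => v; apply/forallP => w.
have [q' [q'w ->]] := M_attained p' n0 (conn v w).
have [q [/eqP qn qw lt]] := imp v w q' (size_tuple q') q'w.
apply: (le_lt_trans (M_le p n0 (q := Tuple qn) qw)).
by rewrite lte_fin.
Qed.

Definition nonimprovable (p : seq (edge H)) : Prop :=
  exists u u', gwalk u u' p /\
    forall p', size p' = size p -> gwalk u u' p' -> ~ improves p' p.

Lemma in_non_improvable_walks n (p : n.-tuple (edge H)) :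
  (0 < n)%N -> p \in non_improvable_walks P n <-> nonimprovable p.
Proof.
move=> n0; split.
  move=> /bigcupP[u _ /bigcupP[u' _]]; rewrite in_set in_walks // => /andP[pw].
  move=> /existsPn nimp; exists u, u'; split=> // p'.
  rewrite size_tuple => /eqP p'n p'w /(@lt_all_M _ p (Tuple p'n) n0) lt.
  by have := nimp (Tuple p'n); rewrite in_walks // p'w lt.
move=> [u [u' [pw nimp]]].
apply/bigcupP; exists u => //; apply/bigcupP; exists u' => //.
rewrite in_set in_walks // pw; apply/existsPn => p'; apply/negP.
rewrite in_walks // => /andP[p'w /(lt_all_M p p' n0)].
by apply: nimp; rewrite ?size_tuple.
Qed.

Definition optimal (p : seq (edge H)) (q : seq (edge G)) : Prop :=
  exists v w, gwalk v w q /\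
    forall q', size q' = size p -> gwalk v w q' -> wt q p <= wt q' p.

Lemma in_minimizers n (p : n.-tuple (edge H)) (q : n.-tuple (edge G)) :
  (0 < n)%N -> q \in minimizers P p <-> optimal p q.
Proof.
move=> n0; split.
  move=> /bigcupP[v _ /bigcupP[w _]]; rewrite in_set in_walks // => /andP[qw].
  rewrite weightE => /eqP Mq; exists v, w; split=> // q'.
  rewrite size_tuple => /eqP q'n q'w.
  by have := M_le p n0 (q := Tuple q'n) q'w; rewrite Mq lee_fin.
move=> [v [w [qw opt]]].
apply/bigcupP; exists v => //; apply/bigcupP; exists w => //.
rewrite in_set in_walks // qw weightE /=.
have [|q' [q'w Mq']] := @M_attained _ p v w n0.
  by exists q; rewrite ?size_tuple.
rewrite eq_le {1}(M_le p n0 qw) Mq' lee_fin.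
by apply: opt; rewrite ?size_tuple.
Qed.

(** An improvement of one factor improves the whole walk when the other factor is kept. *)
Lemma nonimprovable_cat p r : irreducible_graph G ->
  nonimprovable (p ++ r) -> nonimprovable p /\ nonimprovable r.
Proof.
move=> Girr [u [u' [/gwalk_cat[x px rx] nimp]]].
rewrite /improves size_cat in nimp.
split; [exists u, x | exists x, u']; split=> // s sn sw [conn imp].
  apply: (nimp (s ++ r)); first by rewrite size_cat sn.
    by apply/gwalk_cat; exists x.
  split; first exact: connected_byD.
  move=> v w q qn qw.
  have [q1 [q2 [y [-> q1n q2n q1w q2w]]]] := gwalk_split qn qw.
  have [q0 [q0n q0w lt]] := imp _ _ _ q1n q1w.
  exists (q0 ++ q2); split; first by rewrite size_cat q0n q2n.
    by apply/gwalk_cat; exists y.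
  by rewrite !wt_cat ?sn // ltrD2r.
apply: (nimp (p ++ s)); first by rewrite size_cat sn.
  by apply/gwalk_cat; exists x.
split; first by rewrite addnC; apply: connected_byD.
move=> v w q qn qw.
have [q1 [q2 [y [-> q1n q2n q1w q2w]]]] := gwalk_split qn qw.
have [q0 [q0n q0w lt]] := imp _ _ _ q2n q2w.
exists (q1 ++ q0); split; first by rewrite size_cat q1n q0n.
  by apply/gwalk_cat; exists y.
by rewrite !wt_cat // ltrD2l.
Qed.

Lemma optimal_cat p r q s : size q = size p -> size s = size r ->
  optimal (p ++ r) (q ++ s) -> optimal p q /\ optimal r s.
Proof.
move=> qp sr [v [w [/gwalk_cat[x qx sx] opt]]].
split; [exists v, x | exists x, w]; split=> // t tn tw.
  have := opt (t ++ s); rewrite !size_cat tn sr !wt_cat // lerD2r; apply=> //.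
  by apply/gwalk_cat; exists x.
have := opt (q ++ t); rewrite !size_cat tn qp !wt_cat // lerD2l; apply=> //.
by apply/gwalk_cat; exists x.
Qed.

(* Meaningful only when [M p v w] is finite: [fine +oo] is 0. *)
Definition mval (p : seq (edge H)) (v w : vertex G) : int :=
  fine (M P (in_tuple p) v w).

Lemma mval_attained p v w : (0 < size p)%N -> connected_by G (size p) ->
  exists q, [/\ size q = size p, gwalk v w q & wt q p = mval p v w].
Proof.
move=> p0 conn; have [q [qw Mq]] := M_attained (in_tuple p) p0 (conn v w).
by exists q; rewrite size_tuple /mval Mq.
Qed.

Lemma mval_le p v w q :
  (0 < size p)%N -> size q = size p -> gwalk v w q -> mval p v w <= wt q p.
Proof.
move=> p0 qn qw.
have ex : exists2 q, size q = size p & gwalk v w q by exists q.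
have [q' [q'w Mq']] := M_attained (in_tuple p) p0 ex.
move/eqP in qn.
have := M_le (in_tuple p) p0 (q := Tuple qn) qw.
by rewrite /mval Mq' lee_fin.
Qed.

End Potential.

Lemma seq_split (T : Type) m n (s : seq T) : size s = (m + n)%N ->
  exists s1 s2, [/\ s = s1 ++ s2, size s1 = m & size s2 = n].
Proof.
move=> sn; exists (take m s), (drop m s); rewrite cat_take_drop size_drop sn.
by split; rewrite ?addKn // size_takel // sn leq_addr.
Qed.

Lemma gwalk_endpoints (G : digraph) (v v' w w' : vertex G) q :
  (0 < size q)%N -> gwalk v w q -> gwalk v' w' q -> v = v' /\ w = w'.
Proof.
case: q => //= e q _ /andP[/eqP <- qw] /andP[/eqP <- qw']; split=> //.
elim: q e qw qw' => /= [|f q IH] e; first by move=> /eqP <- /eqP.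
by move=> /andP[_ qw] /andP[_ qw']; apply: IH qw qw'.
Qed.

(** Clipping to the interval from [-K] to [K], shifted by [K] into an ordinal. Below the upper
    cutoff, only values at most [-K] get identified. *)
Definition trunc (K : nat) (x : int) : 'I_(K.*2.+1) :=
  inord (absz (Num.min (Num.max (x + K%:Z) 0) (K.*2)%:Z)).

Lemma trunc_eq (K : nat) (x y : int) : trunc K x = trunc K y ->
  x < K%:Z -> y < K%:Z -> x = y \/ x <= - K%:Z /\ y <= - K%:Z.
Proof.
by move=> /(congr1 (@nat_of_ord _)); rewrite /trunc !inordK; lia.
Qed.

(** * Finiteness of the follower sets *)

Section FiniteIndex.
Variables (G H : digraph) (P : edge G -> edge H -> int) (N b : nat).
Variable v0 : vertex G.
Hypothesis N_gt0 : (0 < N)%N.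
Hypothesis Girr : irreducible_graph G.
Hypothesis connG : forall n, (N <= n)%N -> connected_by G n.
Hypothesis connH : forall n, (N <= n)%N -> connected_by H n.
Hypothesis P_le : forall e f, `|P e f| <= b%:Z.

(* [c] bounds the weight of [N] consecutive edges; two values of [mval p] differ
   by at most [4 * c], and the cutoff [K] absorbs two such differences and the
   change of one block of [N] edges. *)
Let c : nat := (N * b)%N.
Let K : nat := (10 * c).+1.

Local Notation wt := (wt P).
Local Notation mval := (mval P).
Local Notation nonimprovable := (nonimprovable P).

Lemma wt_bound q p : size p = N -> `|wt q p| <= c%:Z.
Proof. by rewrite /c => <-; apply: wt_le_size. Qed.

(** Rerouting the first and the last [N] edges of an optimal walk to the other endpoints costs at
    most [2 * c] each. *)
Lemma mval_osc p v w v' w' : (N.*2 <= size p)%N ->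
  mval p v w <= mval p v' w' + (4 * c)%:Z.
Proof.
move=> pN; have p0 : (0 < size p)%N by lia.
have [|q [qn qw <-]] := mval_attained P v' w' p0; first by apply: connG; lia.
have [|p1 [p' [pE p1n p'n]]] := @seq_split _ N (size p - N.*2 + N) p; first lia.
have [p2 [p3 [p'E p2n p3n]]] := seq_split p'n.
have [|q1 [q' [x [qE q1n q'n q1w q'w]]]] :=
  gwalk_split (m := N) (n := size p - N.*2 + N) _ qw; first lia.
have [q2 [q3 [y [q'E q2n q3n q2w q3w]]]] := gwalk_split q'n q'w.
have [r1 r1n r1w] := connG (leqnn N) v x.
have [r3 r3n r3w] := connG (leqnn N) y w.
have := @mval_le _ _ P p v w (r1 ++ q2 ++ r3) p0.
rewrite qE q'E pE p'E !wt_cat ?r1n ?q1n ?q2n //.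
have := wt_bound r1 p1n; have := wt_bound r3 p3n.
have := wt_bound q1 p1n; have := wt_bound q3 p3n.
move=> h1 h2 h3 h4 h5; suff: mval p v w <= wt r1 p1 + (wt q2 p2 + wt r3 p3).
  by rewrite pE p'E; lia.
rewrite pE p'E; apply: h5; first by rewrite !size_cat r1n q2n r3n p1n p2n p3n.
by apply/gwalk_cat; exists x => //; apply/gwalk_cat; exists y.
Qed.

(* If [p'] were much more expensive than [p], rerouting its last [N] edges to
   the endpoint of [p] would improve [p]. *)
Lemma mval_upper p p' u u' u'' v w : (N.*2 <= size p)%N -> nonimprovable p ->
  gwalk u u' p -> gwalk u u'' p' -> size p' = size p ->
  mval p' v w - mval p v0 v0 < K%:Z.
Proof.
move=> pN [x [x' [pw nimp]]] pw' p'w p'n; rewrite ltNge; apply/negP => big.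
have p0 : (0 < size p)%N by lia.
have [? ?] := gwalk_endpoints p0 pw pw'; subst x x'.
have p'N : size p' = (size p - N + N)%N by lia.
have [a [d [y [p'E an dn aw dw]]]] := gwalk_split p'N p'w.
have [d' d'n d'w] := connH (leqnn N) y u'.
apply: (nimp (a ++ d')); first by rewrite size_cat; lia.
  by apply/gwalk_cat; exists y.
have conn : connected_by G (size p) by apply: connG; lia.
split=> // v1 w1 q qn qw.
have [q0 [q0n q0w q0E]] := mval_attained P v1 w1 p0 conn.
exists q0; split=> //; rewrite q0E.
have [|q1 [q2 [z [qE q1n q2n _ _]]]] :=
  gwalk_split (m := size p - N) (n := N) _ qw.
  by lia.
have := @mval_le _ _ P p' v1 w1 q; rewrite p'n => /(_ p0 qn qw).
rewrite p'E qE !wt_cat ?q1n ?an // -p'E.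
have := wt_bound q2 dn; have := wt_bound q2 d'n.
have := @mval_osc p' v w v1 w1; have := @mval_osc p v1 w1 v0 v0.
rewrite p'n => /(_ pN) h1 /(_ pN) h2; move: big; rewrite /K; lia.
Qed.

(* If [p'] is much cheaper than [p] and [p' r'] still improves [p r], then the
   gain is due to [r'], whatever the preceding [N] edges are. *)
Lemma improves_suffix p p' r r' d d' v w : (N.*2 <= size p)%N ->
  size p' = size p -> size r' = size r -> size d = N -> size d' = N ->
  mval p' v w - mval p v0 v0 <= - K%:Z ->
  improves P (p' ++ r') (p ++ r) -> improves P (d' ++ r') (d ++ r).
Proof.
move=> pN p'n r'n dn d'n small [_ imp].
have p0 : (0 < size p)%N by lia.
have conn : connected_by G (size p') by apply: connG; lia.
split; first by apply: connG; rewrite size_cat dn leq_addr.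
move=> x y q qn qw; rewrite size_cat dn in qn.
have [q1 [q2 [t [-> q1n q2n q1w q2w]]]] := gwalk_split qn qw.
(* The block [q1] over [d'] is exchanged for an optimal walk over [p'] with the same end [t], so
   that [imp] applies. *)
have [|q0 [q0n q0w q0E]] := mval_attained P v0 t _ conn; first by rewrite p'n.
have [||s [sn sw]] := imp v0 y (q0 ++ q2).
- by rewrite !size_cat q0n q2n p'n.
- by apply/gwalk_cat; exists t.
rewrite size_cat in sn.
have [s1 [s2 [z [-> s1n s2n s1w s2w]]]] := gwalk_split sn sw.
(* Only the part [s2] over [r] is kept; [N] edges lead from [x] to its start. *)
have [s0 s0n s0w] := connG (leqnn N) x z.
rewrite !wt_cat ?q1n // q0E => lt; exists (s0 ++ s2).
split; first by rewrite !size_cat s0n s2n dn.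
  by apply/gwalk_cat; exists z.
rewrite wt_cat ?s0n //.
have := wt_bound s0 dn; have := wt_bound q1 d'n.
have := @mval_osc p' v0 t v w; have := @mval_osc p v0 v0 v0 z.
rewrite p'n => /(_ pN) h1 /(_ pN) h2.
have := mval_le P p0 s1n s1w; move: small; rewrite /K; lia.
Qed.

(** A first block matters only through the optimal weight up to the junction. Exchanging [p1'] for
    [p2'] and [p2] for [p1] shifts both sides by the same amount, so the gain survives. *)
Lemma improves_transfer p1 p2 p1' p2' r r' :
  (N <= size p1)%N -> (N <= size p2)%N ->
  size p1' = size p1 -> size p2' = size p2 -> size r' = size r ->
  (forall v w, mval p1' v w - mval p1 v0 v0 = mval p2' v w - mval p2 v0 v0) ->
  (forall v w, mval p1 v w - mval p1 v0 v0 = mval p2 v w - mval p2 v0 v0) ->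
  improves P (p2' ++ r') (p2 ++ r) -> improves P (p1' ++ r') (p1 ++ r).
Proof.
move=> p1N p2N p1'n p2'n r'n h' h [_ imp].
have p1_gt0 : (0 < size p1)%N by apply: leq_trans p1N.
have p2_gt0 : (0 < size p2)%N by apply: leq_trans p2N.
split; first by apply: connG; rewrite size_cat (leq_trans p1N) ?leq_addr.
move=> v w q qn qw; rewrite size_cat in qn.
have [q1 [q2 [y [-> q1n q2n q1w q2w]]]] := gwalk_split qn qw.
have [||q0 [q0n q0w q0E]] := @mval_attained _ _ P p2' v y; rewrite ?p2'n //.
  exact: connG.
have [||s [sn sw]] := imp v w (q0 ++ q2).
- by rewrite !size_cat q0n q2n p2'n.
- by apply/gwalk_cat; exists y.
rewrite size_cat in sn.
have [s1 [s2 [t [-> s1n s2n s1w s2w]]]] := gwalk_split sn sw.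
have [|s0 [s0n s0w s0E]] := @mval_attained _ _ P p1 v t p1_gt0.
  exact: connG.
rewrite !wt_cat ?q1n // q0E => lt; exists (s0 ++ s2).
split; first by rewrite !size_cat s0n s2n.
  by apply/gwalk_cat; exists t.
rewrite wt_cat // s0E.
have := mval_le P p2_gt0 s1n s1w; have := @mval_le _ _ P p1' v y q1.
rewrite p1'n => /(_ p1_gt0 q1n q1w).
have := h' v y; have := h v t; lia.
Qed.

(** * Finite states of walks and the transfer of follower sets *)

Definition rel_mval (p p' : seq (edge H)) :
    {ffun vertex G * vertex G -> 'I_(K.*2.+1)} :=
  [ffun z => trunc K (mval p' z.1 z.2 - mval p v0 v0)].

(** Competitors [p'] with any target are recorded, since an improvement of an extension of [p] may
    cross the junction at another vertex. Normalizing by an entry of [mval p] keeps their cost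
    comparable with that of [p]. *)
Definition walk_state (p : seq (edge H)) :=
  ([set z : vertex H * vertex H | gwalk z.1 z.2 p], rel_mval p p,
   [set z : vertex H * vertex H * {ffun vertex G * vertex G -> 'I_(K.*2.+1)} |
     `[< exists p', [/\ size p' = size p, gwalk z.1.1 z.1.2 p'
                      & rel_mval p p' = z.2] >]]).

Lemma walk_state_endpoints p p' u u' :
  walk_state p = walk_state p' -> gwalk u u' p -> gwalk u u' p'.
Proof.
by move=> [/setP/(_ (u, u')) + _ _]; rewrite !inE /= => <-.
Qed.

(** By [mval_osc] these differences stay strictly inside the cutoff, so truncation loses nothing. *)
Lemma walk_state_mval p p' v w :
  (N.*2 <= size p)%N -> (N.*2 <= size p')%N -> walk_state p = walk_state p' ->
  mval p v w - mval p v0 v0 = mval p' v w - mval p' v0 v0.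
Proof.
move=> pN p'N [_ /ffunP/(_ (v, w)) + _]; rewrite !ffunE /= => /trunc_eq.
have := mval_osc v w v0 v0 pN; have := mval_osc v0 v0 v w pN.
have := mval_osc v w v0 v0 p'N; have := mval_osc v0 v0 v w p'N.
rewrite /K; lia.
Qed.

Lemma nonimprovable_follow w w' : (N.*2 <= size w)%N -> (N.*2 <= size w')%N ->
  nonimprovable w -> nonimprovable w' -> walk_state w = walk_state w' ->
  forall r, nonimprovable (w ++ r) -> nonimprovable (w' ++ r).
Proof.
have le2 n : (N.*2 <= n)%N -> (N <= n)%N.
  by apply: leq_trans; rewrite -addnn leq_addr.
move=> wN w'N gw gw' st r gwr; have [u [z [wrw nimp]]] := gwr.
have /gwalk_cat[u' ww rw] := wrw; have w'w := walk_state_endpoints st ww.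
exists u, z; split; first by apply/gwalk_cat; exists u'.
move=> s sn sw imp; rewrite size_cat in sn.
have [s1 [s2 [u'' [sE s1n s2n s1w s2w]]]] := gwalk_split sn sw.
(* Equal states provide a competitor [s0] of [w] that matches the first part [s1] of the improvement
   of [w' ++ r]. *)
have /asboolP[s0 [s0n s0w s0E]] : `[< exists p', [/\ size p' = size w,
    gwalk u u'' p' & rel_mval w p' = rel_mval w' s1] >].
  case: st => _ _ /setP/(_ (u, u'', rel_mval w' s1)); rewrite !inE /= => ->.
  by apply/asboolP; exists s1.
have cmp v y : mval s0 v y - mval w v0 v0 = mval s1 v y - mval w' v0 v0 \/
    mval s1 v y - mval w' v0 v0 <= - K%:Z.
  move/ffunP/(_ (v, y)): s0E; rewrite !ffunE /=.
  have lt0 := mval_upper v y wN gw ww s0w s0n.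
  have lt1 := mval_upper v y w'N gw' w'w s1w s1n.
  by move=> /trunc_eq/(_ lt0 lt1)[|[_]]; [left|right].
rewrite {}sE in imp.
have [[v [y small]]|nsmall] :=
  pselect (exists v y, mval s1 v y - mval w' v0 v0 <= - K%:Z).
  (* Below the cutoff, the gain is due to [s2] and also works behind the last [N] edges [d] of [w].
     This contradicts the non-improvability of the factor [d ++ r]. *)
  have wNN : size w = (size w - N + N)%N by lia.
  have [a [d [x [wE an dn aw dw]]]] := gwalk_split wNN ww.
  have [d' d'n d'w] := connH (leqnn N) x u''.
  move: gwr; rewrite wE -catA.
  move=> /(nonimprovable_cat Girr)[_ [x1 [z1 [drw dr_nimp]]]].
  have drw' : gwalk x z (d ++ r) by apply/gwalk_cat; exists u'.
  have [|? ?] := gwalk_endpoints _ drw drw'.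
    by rewrite size_cat dn addn_gt0 N_gt0.
  subst x1 z1; apply: (dr_nimp (d' ++ s2)).
  - by rewrite !size_cat s2n dn d'n.
  - by apply/gwalk_cat; exists u''.
  - exact: improves_suffix small imp.
(* Otherwise the relative matrices of [s0] and [s1] agree exactly, and [s0 ++ s2] improves
   [w ++ r]. *)
apply: (nimp (s0 ++ s2)); first by rewrite !size_cat s0n s2n.
  by apply/gwalk_cat; exists u''.
apply: (improves_transfer (le2 _ wN) (le2 _ w'N) s0n s1n s2n _ _ imp) => v y.
  by case: (cmp v y) => // small; case: nsmall; exists v, y.
exact: walk_state_mval.
Qed.

(** The choice between junctions [x] and [y] depends on [p] only through [mval p v y - mval p v x],
    which equal states share. *)
Lemma optimal_follow p p' q q' r s :
  (N.*2 <= size p)%N -> (N.*2 <= size p')%N -> size q = size p ->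
  size q' = size p' -> walk_state p = walk_state p' ->
  (forall v w, gwalk v w q -> gwalk v w q') ->
  optimal P p' q' -> size s = size r ->
  optimal P (p ++ r) (q ++ s) -> optimal P (p' ++ r) (q' ++ s).
Proof.
move=> pN p'N qn q'n st qq' [v1 [x1 [q'w1 opt']]] sn.
move=> [v [w [/gwalk_cat[x qw sw] opt]]].
have p'_gt0 : (0 < size p')%N by lia.
have p_gt0 : (0 < size p)%N by lia.
have q'w := qq' v x qw.
have [|? ?] := gwalk_endpoints _ q'w1 q'w; first by rewrite q'n.
subst v1 x1; exists v, w; split; first by apply/gwalk_cat; exists x.
move=> t tn tw; rewrite size_cat in tn.
have [t1 [t2 [y [-> t1n t2n t1w t2w]]]] := gwalk_split tn tw.
have [|m [mn mw mE]] := mval_attained P v y p_gt0; first by apply: connG; lia.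
have [|m' [m'n m'w m'E]] := mval_attained P v x p'_gt0.
  by apply: connG; lia.
have := opt (m ++ t2); rewrite !size_cat mn t2n !wt_cat // mE => /(_ erefl) le.
have {}le : wt q p + wt s r <= mval p v y + wt t2 r.
  by apply: le; apply/gwalk_cat; exists y.
have := opt' m' m'n m'w; rewrite m'E.
have := mval_le P p_gt0 qn qw; have := mval_le P p'_gt0 t1n t1w.
have := walk_state_mval v x pN p'N st; have := walk_state_mval v y pN p'N st.
lia.
Qed.

(** * The two shifts described by their languages *)

Lemma X_daggerP (x : int -> edge H) :
  X_dagger P x <-> forall m k, nonimprovable (word x m k.+1).
Proof.
split=> [[_ h] m k|h].
  (* Windows with [m < n] have length at least 2; a single letter is covered as a factor of a longer
     word. *)
  have : nonimprovable (word x m k.+2).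
    have : m < m + k.+1%:Z by rewrite ltrDl.
    by move/h/(in_non_improvable_walks P _ (ltn0Sn _));
      rewrite val_window addrAC subrr add0r.
  by rewrite -addn1 word_cat => /(nonimprovable_cat Girr)[].
split=> [n|m n _]; last first.
  by apply/(in_non_improvable_walks P _ (ltn0Sn _)); rewrite val_window.
have [u [u' []]] := h n 1%N; rewrite /word /= addr0.
by move=> /and3P[_ /eqP-> _].
Qed.

Lemma Y_daggerP (z : int -> edge H * edge G) :
  Y_dagger P z <-> forall m k, nonimprovable (unzip1 (word z m k.+1)) /\
    optimal P (unzip1 (word z m k.+1)) (unzip2 (word z m k.+1)).
Proof.
have u1 m k : unzip1 (word z m k) = word (fun n => (z n).1) m k.
  by rewrite /word /unzip1 -map_comp.
have u2 m k : unzip2 (word z m k) = word (fun n => (z n).2) m k.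
  by rewrite /word /unzip2 -map_comp.
split=> [[/X_daggerP hx _ h] m k|h].
  rewrite u1 u2; split; first exact: hx.
  have : m < m + k.+1%:Z by rewrite ltrDl.
  move/h/(in_minimizers P _ _ (ltn0Sn _)).
  rewrite !val_window addrAC subrr add0r /=.
  by rewrite -addn1 !word_cat => /optimal_cat[]; rewrite ?size_word.
split.
- by apply/X_daggerP => m k; rewrite -u1; case: (h m k).
- move=> n; have [_ [v [w []]]] := h n 1%N; rewrite u2 /word /= addr0.
  by move=> /and3P[_ /eqP-> _].
- move=> m n _; apply/(in_minimizers P _ _ (ltn0Sn _)).
  by rewrite !val_window -u1 -u2; case: (h m (absz (n - m))).
Qed.

Lemma sofic_X_dagger : sofic (X_dagger P).
Proof.
apply: (@sofic_of_language _ _ nonimprovable walk_state N.*2) X_daggerP.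
- by move=> p r; apply: nonimprovable_cat.
- exact: nonimprovable_follow.
Qed.

Lemma sofic_Y_dagger : sofic (Y_dagger P).
Proof.
pose state (z : seq (edge H * edge G)) := (walk_state (unzip1 z),
  [set x : vertex G * vertex G | gwalk x.1 x.2 (unzip2 z)]).
have size12 (z : seq (edge H * edge G)) : size (unzip2 z) = size (unzip1 z).
  by rewrite !size_map.
pose lang z := nonimprovable (unzip1 z) /\ optimal P (unzip1 z) (unzip2 z).
apply: (@sofic_of_language _ _ lang state N.*2) Y_daggerP; rewrite /lang.
  move=> z z'; rewrite /unzip1 /unzip2 !map_cat.
  by move=> [/(nonimprovable_cat Girr)[? ?] /optimal_cat[]]; rewrite ?size_map.
move=> z z'; rewrite -(size_map fst z) -(size_map fst z') => zN z'N.
move=> [gz oz] [gz' oz'] stz.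
have [st ends] := (congr1 fst stz, congr1 snd stz).
move=> r; rewrite /unzip1 /unzip2 !map_cat => -[gzr ozr]; split.
  exact: nonimprovable_follow gzr.
apply: (optimal_follow zN z'N (size12 z) (size12 z') st _ oz' _ ozr).
  by move=> v w; move/setP/(_ (v, w)): ends; rewrite !inE /= => ->.
by rewrite !size_map.
Qed.

End FiniteIndex.

Theorem theoremF (G H : digraph) (P : edge G -> edge H -> int)
    (hG : primitive_graph G) (hH : primitive_graph H) :
  sofic (X_dagger P) /\ sofic (Y_dagger P).
Proof.
have [v0] := primitive_has_vertex hG; have Girr := hG.1.
have [NG connG] := primitive_connected_by hG.
have [NH connH] := primitive_connected_by hH.
(* The successor makes [N] positive, so that a block of [N] edges determines its endpoints. *)
pose N := (maxn NG NH).+1.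
pose b := \max_(z : edge G * edge H) absz (P z.1 z.2).
have P_le e f : `|P e f| <= b%:Z.
  by rewrite -abszE lez_nat (@leq_bigmax _ (fun z => absz (P z.1 z.2)) (e, f)).
have connGN n : (N <= n)%N -> connected_by G n by move=> ?; apply: connG; lia.
have connHN n : (N <= n)%N -> connected_by H n by move=> ?; apply: connH; lia.
by split; [apply: (@sofic_X_dagger _ _ P N b v0)
          | apply: (@sofic_Y_dagger _ _ P N b v0)].
Qed.
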